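(* Let $v>0$ and put $$w=\left(\sqrt{3+v^2}+\sqrt3\right)^{2/3}v^{-2/3},\qquad x=\frac12\left(w+1+\frac1w\right).$$ For any random variable $Z$ with mean $0$ and variance $1$ whose distribution is unimodal with mode at $0$, the inequality $$P(Z\geq v)\leq \frac{2(x-1)}{v^2x^2+2x+1}$$ holds, with equality if $Z=UY$ with $U$ and $Y$ independent random variables, $U$ uniform on the unit interval, and $Y$ taking the values $-\frac{3}{vx}$ and $vx$ with probabilities $\frac{v^2x^2}{3+v^2x^2}$ and $\frac{3}{3+v^2x^2}$, respectively.
   Context: A distribution on $\mathbb{R}$ is unimodal with mode at $M$ if its distribution function is convex on $(-\infty,M)$ and concave on $[M,\infty)$. (A unimodal distribution may thus have an atom, but only at the mode $M$.) *)

(* Defs.v *)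
From HB Require Import structures.
From mathcomp Require Import all_boot all_order all_algebra.
From mathcomp Require Import all_classical all_reals all_analysis.

Set Implicit Arguments.
Unset Strict Implicit.
Unset Printing Implicit Defensive.

Import Order.TTheory GRing.Theory Num.Theory.
Import numFieldNormedType.Exports.

Local Open Scope classical_set_scope.
Local Open Scope ring_scope.

(* Concavity on [M, +oo[ is convexity of the opposite function. An atom at M
   is allowed because M is excluded from the first interval. *)
Definition unimodal d (T : measurableType d) (R : realType)
    (P : probability T R) (X : {RV P >-> R}) (M : R) : Prop :=
  convex_function (`]-oo, M[ : set R^o) (fun r => fine (cdf X r)) /\
  convex_function (`[M, +oo[ : set R^o) (fun r => - fine (cdf X r)).

Definition independent_RVs d d1 d2 (T : measurableType d)
    (T1 : measurableType d1) (T2 : measurableType d2) (R : realType)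
    (P : probability T R) (X : {RV P >-> T1}) (Y : {RV P >-> T2}) : Prop :=
  forall (A : set T1) (B : set T2), measurable A -> measurable B ->
    P (X @^-1` A `&` Y @^-1` B) = (P (X @^-1` A) * P (Y @^-1` B))%E.

(* The two laws are compared on measurable sets only: the values of measures
   elsewhere carry no meaning. *)
Definition uniform_RV d (T : measurableType d) (R : realType)
    (P : probability T R) (X : {RV P >-> R}) (a b : R) (ab : a < b) : Prop :=
  forall A : set R, measurable A -> distribution P X A = uniform_prob ab A.

(* Main.v *)
Require Import Defs.
From HB Require Import structures.
From mathcomp Require Import all_boot all_order all_algebra.
From mathcomp Require Import all_classical all_reals all_analysis.
From mathcomp Require Import measurable_realfun ring lra.

(** Why the bound holds.  By Khinchine's theorem a distribution unimodal at 0
is the law of [U * Y] with [U] uniform on the unit interval and independent of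
[Y]; mean 0 and variance 1 of [Z] become mean 0 and second moment 3 of [Y],
and [P (Z >= v)] becomes the mean of [(1 - v / Y)^+].  Choose a parabola
[q y = c * (y + e) ^+ 2] that stays above [(1 - v / y)^+], with contact at [- e]
and tangentially at [y0 = v * x].  Then the mean of [q Y], which is
[c * (3 + e ^+ 2)], bounds the tail.  Equality requires [Y] to live on the two
contact points, and mean 0 together with second moment 3 then forces
[e * y0 = 3].  Tangency at [y0] now says [2 v^2 x^3 = 3 v^2 x^2 + 3], a cubic
which the substitution [2 x - 1 = w + 1 / w] turns into a quadratic for [w ^ 3];
this is where the formula for [w] comes from ([parameter_cubic],
[extremal_parameters]).

The argument is carried out on the distribution function of [Z].  The mean of
[q Y] is the mean of [Q Z] with [Q z = (z * q z)'], see [majorant], so the claim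
is that [Q Z - 1_(Z >= v)] has nonnegative mean.  A primitive of
[Q - 1_(>= v)] is [G z = z * q z - (z - v)^+], which vanishes at [- e], at [0]
and at [y0].  Between consecutive zeros of [G] the integrand changes sign exactly
once, at [- e / 3] and at [v] respectively.  Take the supporting line of the
convex or concave distribution function at such a sign change, of slope [k]
([supporting_slope]).  On the side where the integrand is nonnegative the law of
[Z] has at least the mass that the density [k] would give to any interval, and
on the side where it is nonpositive at most that mass.  Hence the integral over
the whole piece is at least [k] times the increment of [G], that is 0
([integral_ge_slope], [integral_majorant_neg], [integral_majorant_pos]).
Outside [- e, y0] the integrand is nonnegative pointwise.

For the equality case the distribution function of [U * Y] is explicit: it is
affine on [- e, 0] and on [0, y0].  Unimodality and the value of the tail are
read off from it, and the moments follow because on each of the two intervals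
the law is a multiple of Lebesgue measure ([two_point_product_cdf],
[two_point_product_moment]). *)

Set Implicit Arguments.
Unset Strict Implicit.
Unset Printing Implicit Defensive.

Import Order.TTheory GRing.Theory Num.Theory.
Import numFieldNormedType.Exports.

Local Open Scope classical_set_scope.
Local Open Scope ring_scope.

(** * Convex functions of a real variable *)

Lemma convex_functionP (R : realType) (D : set R) (f : R -> R) :
  convex_function (D : set R^o) f <->
  forall t a c : R, 0 <= t -> t <= 1 -> D a -> D c ->
    f (t * a + (1 - t) * c) <= t * f a + (1 - t) * f c.
Proof.
split => [cf t a c t0 t1 Da Dc|cf t a c].
  have := cf (Itv01 t0 t1) a c; rewrite !inE; exact.
by rewrite !inE => Da Dc; apply: (cf t%:num a c).
Qed.

Lemma convex_chord (R : realType) (D : set R) (f : R -> R) (a b c : R) :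
  convex_function (D : set R^o) f -> D a -> D c -> a < b -> b < c ->
  (f b - f a) / (b - a) <= (f c - f b) / (c - b).
Proof.
move=> /convex_functionP cf Da Dc ab bc.
have ac : 0 < c - a by lra.
pose t := (c - b) / (c - a).
have h0 : 0 <= t by apply: divr_ge0; lra.
have h1 : t <= 1 by rewrite ler_pdivrMr// mul1r; lra.
have := cf t a c h0 h1 Da Dc.
have -> : t * a + (1 - t) * c = b by rewrite /t; field; rewrite gt_eqF.
move=> fb.
have et : t * (c - a) = c - b by rewrite /t divfK// gt_eqF.
rewrite ler_pdivrMr ?subr_gt0// mulrAC ler_pdivlMr ?subr_gt0//.
have : f b * (c - a) <= (t * f a + (1 - t) * f c) * (c - a).
  by rewrite ler_wpM2r// ltW.
have -> : (t * f a + (1 - t) * f c) * (c - a)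
  = (t * (c - a)) * f a + ((c - a) - t * (c - a)) * f c by ring.
rewrite et; nra.
Qed.

(** The supremum of the slopes of the chords ending at [c] works: it is finite
because a chord starting at [c] is at least as steep as all of them. *)
Lemma supporting_slope (R : realType) (D : set R) (f : R -> R) (l c r : R) :
  convex_function (D : set R^o) f -> D l -> D c -> D r -> l < c -> c < r ->
  exists k : R,
    (forall s t, D s -> D t -> s <= t -> t <= c -> f t - f s <= k * (t - s)) /\
    (forall s t, D s -> D t -> c <= s -> s <= t -> k * (t - s) <= f t - f s).
Proof.
move=> cf Dl Dc Dr lc cr.
pose A := [set (f c - f s) / (c - s) | s in [set s | D s /\ s < c]].
have Al : A ((f c - f l) / (c - l)) by exists l.
have Aub x t : A x -> D t -> c < t -> x <= (f t - f c) / (t - c).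
  by move=> [s [Ds sc] <-] Dt ct; exact: (convex_chord cf).
have supA : has_sup A.
  split; first by eexists; exact: Al.
  by exists ((f r - f c) / (r - c)) => x Ax; exact: Aub.
exists (sup A); split => [s t Ds Dt st tc|s t Ds Dt cs st].
  move: st; rewrite le_eqVlt => /predU1P[->|st]; first by rewrite !subrr mulr0.
  rewrite -ler_pdivrMr ?subr_gt0//.
  move: tc; rewrite le_eqVlt => /predU1P[tc|tc].
    by subst t; apply: ub_le_sup; [exact: supA.2|exists s].
  apply: (le_trans (convex_chord cf Ds Dc st tc)).
  by apply: ub_le_sup; [exact: supA.2|exists t].
move: st; rewrite le_eqVlt => /predU1P[->|st]; first by rewrite !subrr mulr0.
rewrite -ler_pdivlMr ?subr_gt0//.
apply: ge_sup; first by exists ((f c - f l) / (c - l)).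
move=> x Ax; move: cs; rewrite [c <= s]le_eqVlt => /predU1P[cs|cs].
  by subst s; exact: Aub.
apply: (le_trans (Aub _ _ Ax Ds cs)).
exact: (convex_chord cf).
Qed.

Lemma supporting_slope_left (R : realType) (f : R -> R) (c : R) :
  convex_function (`]-oo, 0[%classic : set R^o) f -> c < 0 ->
  exists k : R,
    (forall s t : R, s <= t -> t <= c -> f t - f s <= k * (t - s)) /\
    (forall s t : R, c <= s -> s <= t -> t < 0 -> k * (t - s) <= f t - f s).
Proof.
move=> cf c0.
have D (z : R) : z < 0 -> `]-oo, 0[%classic z by rewrite /= in_itv.
have c1c : c - 1 < c by lra.
have cc2 : c < c / 2 by lra.
have [|||k [kL kR]] := supporting_slope cf _ _ _ c1c cc2.
- by apply: D; lra.
- exact: D.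
- by apply: D; lra.
exists k; split => s t.
  by move=> st tc; apply: kL => //; apply: D; lra.
by move=> cs st t0; apply: kR => //; apply: D; lra.
Qed.

Lemma supporting_slope_right (R : realType) (f : R -> R) (c : R) :
  convex_function (`[0, +oo[%classic : set R^o) (fun z => - f z) -> 0 < c ->
  exists k : R,
    (forall s t : R, 0 <= s -> s <= t -> t <= c -> k * (t - s) <= f t - f s) /\
    (forall s t : R, c <= s -> s <= t -> f t - f s <= k * (t - s)).
Proof.
move=> cf c0.
have D (z : R) : 0 <= z -> `[0, +oo[%classic z by rewrite /= in_itv/= andbT.
have cc1 : c < c + 1 by lra.
have [|||k [kL kR]] := supporting_slope cf _ _ _ c0 cc1.
- by apply: D; lra.
- by apply: D; lra.
- by apply: D; lra.
exists (- k); split => s t.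
  move=> s0 st tc; have := kL s t (D _ s0) (D _ (le_trans s0 st)) st tc.
  by rewrite opprK mulNr; lra.
move=> cs st; have s0 : 0 <= s by lra.
have := kR s t (D _ s0) (D _ (le_trans s0 st)) cs st.
by rewrite opprK mulNr; lra.
Qed.

(** * Comparing a measure with a constant density *)

(** Cut [a, b] into [n] equal steps: the decrements telescope to at most
[C * (b - a) / n * (nu b - nu a)], which tends to 0.  This replaces a
differentiation argument for functions [Phi] that have no derivative. *)
Lemma le_of_small_decrements (R : realType) (Phi nu : R -> R) (C a b : R) :
  a <= b ->
  (forall s t, a <= s -> s <= t -> t <= b ->
    - (C * (t - s) * (nu t - nu s)) <= Phi t - Phi s) ->
  Phi a <= Phi b.
Proof.
move=> ab dPhi.
have H n : - (C * ((b - a) / n.+1%:R) * (nu b - nu a)) <= Phi b - Phi a.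
  set h := (b - a) / n.+1%:R.
  have h0 : 0 <= h by rewrite divr_ge0// subr_ge0.
  pose x i := a + i%:R * h.
  have x0 : x 0%N = a by rewrite /x mul0r addr0.
  have xn : x n.+1 = b by rewrite /x /h mulrC divfK ?pnatr_eq0//; ring.
  have xS i : x i.+1 - x i = h by rewrite /x -natr1; ring.
  rewrite -x0 -xn.
  rewrite -(telescope_sumr (fun i => nu (x i)))//.
  rewrite -(telescope_sumr (fun i => Phi (x i)))//.
  rewrite mulr_sumr -sumrN.
  rewrite !big_mkord; apply: ler_sum => i _.
  rewrite -{1}(xS i); apply: dPhi.
  - by rewrite /x lerDl mulr_ge0.
  - by rewrite -subr_ge0 xS.
  - by rewrite -xn /x lerD2l ler_wpM2r// ler_nat.
rewrite leNgt; apply/negP => PhiE.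
have d0 : 0 < Phi a - Phi b by rewrite subr_gt0.
set K := C * (b - a) * (nu b - nu a).
have [n] : exists n : nat, K / (Phi a - Phi b) < n.+1%:R.
  by exists (Num.truncn (K / (Phi a - Phi b))); exact: truncnS_gt.
rewrite ltr_pdivrMr// => Kn.
have := H n.
have -> : C * ((b - a) / n.+1%:R) * (nu b - nu a) = K / n.+1%:R.
  by rewrite /K; field; rewrite addrC natr1 pnatr_eq0.
rewrite lerNl opprB ler_pdivlMr// mulrC => h.
by move: Kn; rewrite ltNge h.
Qed.

(** On a short interval [g] is almost constant, so its integral is almost
[g s * mu `]s, t]], and the sign condition compares this with
[g s * k * (t - s)], which is almost [k * (H t - H s)].  All errors are of
second order, so [le_of_small_decrements] sums them up.  The sign condition
covers two situations at once: [g >= 0] where the mass of intervals is at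
least that of the density [k], and [g <= 0] where it is at most that. *)
Lemma integral_ge_slope (R : realType)
    (mu : {finite_measure set R -> \bar R})
    (g H : R -> R) (L k a b : R) :
  a <= b -> mu.-integrable `]a, b] (EFin \o g) ->
  (forall s z, a <= s -> s <= z -> z <= b -> `|g z - g s| <= L * (z - s)) ->
  (forall s t, a <= s -> s <= t -> t <= b ->
     `|H t - H s - g s * (t - s)| <= L * (t - s) ^+ 2) ->
  (forall s t, a <= s -> s <= t -> t <= b ->
     0 <= g s * (fine (mu `]s, t]%classic) - k * (t - s))) ->
  k * (H b - H a) <= \int[mu]_(z in `]a, b]) g z.
Proof.
move=> ab ig gL HL gk.
pose I s t := \int[mu]_(z in `]s, t]) g z.
pose m s t := fine (mu `]s, t]%classic).
have muf s t : mu `]s, t]%classic \is a fin_num by rewrite fin_num_measure.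
have cat s t : a <= s -> s <= t -> t <= b ->
    `]a, t]%classic = `]a, s]%classic `|` `]s, t]%classic :> set R.
  by move=> *; rewrite -itv_bndbnd_setU// bnd_simp.
have dis s t : [disjoint (`]a, s]%classic : set R) & `]s, t]%classic].
  apply/disj_setPS => z [] /=; rewrite !in_itv/= => /andP[_ zs] /andP[sz _].
  by move: sz; rewrite ltNge zs.
have sub s t : a <= s -> t <= b ->
    `]s, t]%classic `<=` (`]a, b]%classic : set R).
  move=> s0 tb z /=; rewrite !in_itv/= => /andP[sz zt].
  by rewrite (le_lt_trans s0)// (le_trans zt).
have igS s t : a <= s -> t <= b -> mu.-integrable `]s, t]%classic (EFin \o g).
  by move=> s0 tb; apply: integrableS ig => //; exact: sub.
have mD s t : a <= s -> s <= t -> t <= b -> m a t = m a s + m s t.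
  move=> s0 st tb; rewrite /m (cat s t)// measureU ?fineD ?muf//.
  exact/disj_set2P/dis.
have ID s t : a <= s -> s <= t -> t <= b -> I a t = I a s + I s t.
  move=> s0 st tb; rewrite /I (cat s t)// Rintegral_setU//.
  by rewrite -cat//; apply: igS.
have I0 : I a a = 0 by rewrite /I set_itvoc0 Rintegral_set0.
have Ige s t : a <= s -> s <= t -> t <= b ->
    (g s - L * (t - s)) * m s t <= I s t.
  move=> s0 st tb; rewrite -Rintegral_cst// le_Rintegral//.
  - by apply/finite_measure_integrable_cst.
  - exact: igS.
  move=> z /=; rewrite in_itv/= => /andP[sz zt].
  have := gL s z s0 (ltW sz) (le_trans zt tb).
  rewrite ler_norml => /andP[+ _].
  have L0 : 0 <= L.
    have := le_trans (normr_ge0 _) (gL s z s0 (ltW sz) (le_trans zt tb)).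
    by rewrite pmulr_lge0// subr_gt0.
  have : L * (z - s) <= L * (t - s) by rewrite ler_wpM2l// lerD2r.
  lra.
suff : I a a - k * H a <= I a b - k * H b.
  by rewrite I0 -/(I a b); lra.
apply: (@le_of_small_decrements _ (fun t => I a t - k * H t)
  (fun t => m a t + `|k| * t) L) => // s t s0 st tb.
rewrite (mD s t)// (ID s t)//.
have := Ige s t s0 st tb.
have := gk s t s0 st tb; rewrite -/(m s t).
have : k * (H t - H s - g s * (t - s)) <= `|k| * (L * (t - s) ^+ 2).
  by rewrite (le_trans (ler_norm _))// normrM ler_wpM2l// HL.
set M := m s t; set J := I s t.
nra.
Qed.

Lemma integral_quadratic_ge_slope (R : realType)
    (mu : {finite_measure set R -> \bar R})
    (p q r k a b : R) (g := fun z => 3 * p * z ^+ 2 + 2 * q * z + r)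
    (H := fun z => p * z ^+ 3 + q * z ^+ 2 + r * z) :
  a <= b -> mu.-integrable `]a, b] (EFin \o g) ->
  (forall s t, a <= s -> s <= t -> t <= b ->
     0 <= g s * (fine (mu `]s, t]%classic) - k * (t - s))) ->
  k * (H b - H a) <= \int[mu]_(z in `]a, b]) g z.
Proof.
move=> ab ig gk.
pose M := Num.max `|a| `|b|.
have Mle z : a <= z -> z <= b -> `|z| <= M.
  have aM : `|a| <= M by rewrite le_max lexx.
  have bM : `|b| <= M by rewrite le_max lexx orbT.
  move: aM bM; rewrite !ler_norml => /andP[aM _] /andP[_ bM] az zb.
  by rewrite (le_trans aM)// (le_trans zb).
apply: (@integral_ge_slope _ mu g H (`|p| * (6 * M) + 2 * `|q|)) => //.
- move=> s z s0 sz zb.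
  have -> : g z - g s = (p * (3 * (z + s)) + 2 * q) * (z - s).
    by rewrite /g; ring.
  rewrite normrM (ger0_norm (_ : 0 <= z - s)) ?subr_ge0//.
  rewrite ler_wpM2r ?subr_ge0//.
  rewrite (le_trans (ler_normD _ _))// !normrM (ger0_norm (_ : 0 <= 2))//.
  rewrite lerD2r ler_wpM2l// ger0_norm//.
  have := ler_normD z s; have := Mle z; have := Mle s; lra.
- move=> s t s0 st tb.
  have -> : H t - H s - g s * (t - s) = (p * (t + 2 * s) + q) * (t - s) ^+ 2.
    by rewrite /g /H; ring.
  rewrite normrM (ger0_norm (_ : 0 <= _ ^+ 2)) ?sqr_ge0//.
  rewrite ler_wpM2r ?sqr_ge0//.
  rewrite (le_trans (ler_normD _ _))// normrM lerD//; last first.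
    by rewrite mulr_natl mulr2n lerDl.
  rewrite ler_wpM2l// (le_trans (ler_normD _ _))// normrM (ger0_norm (_ : 0 <= 2))//.
  have := normr_ge0 t; have := Mle t; have := Mle s; lra.
Qed.

(** Both [g] and [- g] satisfy the sign condition of
[integral_quadratic_ge_slope], with equality. *)
Lemma integral_quadratic_uniform (R : realType)
    (mu : {finite_measure set R -> \bar R}) (p q r k a b : R)
    (g := fun z => 3 * p * z ^+ 2 + 2 * q * z + r)
    (H := fun z => p * z ^+ 3 + q * z ^+ 2 + r * z) :
  a <= b -> mu.-integrable `]a, b] (EFin \o g) ->
  (forall s t, a <= s -> s <= t -> t <= b ->
     fine (mu `]s, t]%classic) = k * (t - s)) ->
  \int[mu]_(z in `]a, b]) g z = k * (H b - H a).
Proof.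
move=> ab ig muk; apply/eqP; rewrite eq_le; apply/andP; split; last first.
  apply: integral_quadratic_ge_slope => // s t as_ st tb.
  by rewrite muk// subrr mulr0.
pose g' z := 3 * (- p) * z ^+ 2 + 2 * (- q) * z + (- r).
have g'E : g' = (fun z => -1 * g z) by apply/funext => z; rewrite /g' /g; ring.
have ig' : mu.-integrable `]a, b] (EFin \o g').
  by rewrite g'E; exact: integrableZl ig.
have sign s t : a <= s -> s <= t -> t <= b ->
    0 <= g' s * (fine (mu `]s, t]%classic) - k * (t - s)).
  by move=> as_ st tb; rewrite muk// subrr mulr0.
have := integral_quadratic_ge_slope ab ig' sign.
by rewrite -/g' g'E RintegralZl// /H; lra.
Qed.

(** * The tail of a unimodal law *)

Lemma Rintegral_itv_cat (R : realType)
    (mu : {measure set R -> \bar R}) (f : R -> R)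
    (a b c : itv_bound R) :
  (a <= b)%O -> (b <= c)%O -> mu.-integrable [set` Interval a c] (EFin \o f) ->
  \int[mu]_(z in [set` Interval a c]) f z =
  \int[mu]_(z in [set` Interval a b]) f z +
  \int[mu]_(z in [set` Interval b c]) f z.
Proof.
move=> ab bc; rewrite (itv_bndbnd_setU ab bc) => fi.
rewrite Rintegral_setU//.
apply/disj_setPS => z [] /=; rewrite !itv_boundlr => /andP[_ zb] /andP[bz _].
by move: (le_trans zb bz); rewrite bnd_simp ltxx.
Qed.

Lemma le0_of_le_small (R : realFieldType) (x K d : R) :
  0 < d -> (forall t, 0 < t -> t < d -> x <= K * t) -> x <= 0.
Proof.
move=> d0 xK; rewrite leNgt; apply/negP => x0.
pose t := Num.min (d / 2) (x / (2 * (`|K| + 1))).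
have K1 : 0 < 2 * (`|K| + 1) by rewrite mulr_gt0// ltr_wpDl.
have t0 : 0 < t by rewrite /t lt_min !divr_gt0.
have td : t < d by rewrite /t gt_min; apply/orP; left; lra.
have tx : t * (2 * (`|K| + 1)) <= x.
  by rewrite -ler_pdivlMr// /t ge_min lexx orbT.
have := xK t t0 td; have := ler_norm K; nra.
Qed.

Lemma measure_itv_oc (R : realType) (mu : probability R R)
    (s t : R) : s <= t ->
  fine (mu `]s, t]%classic) =
  fine (mu `]-oo, t]%classic) - fine (mu `]-oo, s]%classic).
Proof.
move=> st.
have -> : `]-oo, t]%classic = `]-oo, s]%classic `|` `]s, t]%classic :> set R.
  by rewrite -itv_bndbnd_setU// bnd_simp.
rewrite measureU//=; last first.
  apply/seteqP; split => // z [] /=; rewrite !in_itv/= => zs /andP[sz _].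
  by move: sz; rewrite ltNge zs.
by rewrite fineD ?fin_num_measure// addrC addKr.
Qed.

(** The supporting slope at [v / 2] bounds the mass of [`]v - t, v]] by a
multiple of [t]. *)
Lemma concave_cdf_no_atom (R : realType)
    (mu : probability R R) (v : R) :
  convex_function (`[0, +oo[%classic : set R^o)
    (fun z => - fine (mu `]-oo, z]%classic)) ->
  0 < v -> mu [set v] = 0%E.
Proof.
move=> ccvF v0.
have v2 : 0 < v / 2 by rewrite divr_gt0.
have [k [_ kR]] := supporting_slope_right ccvF v2.
suff : fine (mu [set v]) <= 0.
  move=> h; apply/eqP; rewrite -[mu [set v]]fineK ?fin_num_measure//.
  by rewrite eqe eq_le h fine_ge0.
apply: (@le0_of_le_small _ _ k (v / 2)) => // t t0 tv.
apply: (@le_trans _ _ (fine (mu `]v - t, v]%classic))).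
  rewrite fine_le ?fin_num_measure//; apply: le_measure; rewrite ?inE//.
  by move=> z /= ->; rewrite in_itv/= lexx andbT; lra.
rewrite measure_itv_oc; last lra.
by apply: (le_trans (kR _ _ _ _)); rewrite ?opprB; lra.
Qed.

(** The derivative of [z * q z] for the parabola [q z = c * (z + e) ^+ 2].  The
coefficients are left in the shape [3 * a * z ^+ 2 + 2 * b * z + r] of the
derivative of a cubic. *)
Definition majorant (R : realType) (c e z : R) : R :=
  3 * c * z ^+ 2 + 2 * (2 * c * e) * z + c * e ^+ 2.

Lemma majorantE (R : realType) (c e z : R) :
  majorant c e z = c * ((z + e) * (3 * z + e)).
Proof. by rewrite /majorant; ring. Qed.

Lemma majorant_le0 (R : realType) (c e z : R) : 0 <= c -> 0 <= e ->
  - e <= z -> z <= - (e / 3) -> majorant c e z <= 0.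
Proof.
move=> c0 e0 ez ze.
by rewrite majorantE mulr_ge0_le0// mulr_ge0_le0; lra.
Qed.

Lemma majorant_ge0_left (R : realType) (c e z : R) : 0 <= c -> 0 <= e ->
  z <= - e -> 0 <= majorant c e z.
Proof. by move=> c0 e0 ze; rewrite majorantE mulr_ge0// mulr_le0; lra. Qed.

Lemma majorant_ge0_right (R : realType) (c e z : R) : 0 <= c -> 0 <= e ->
  - (e / 3) <= z -> 0 <= majorant c e z.
Proof. by move=> c0 e0 ez; rewrite majorantE mulr_ge0// mulr_ge0; lra. Qed.

Lemma majorant_le (R : realType) (c e s t : R) : 0 <= c -> 0 <= e ->
  0 <= s -> s <= t -> majorant c e s <= majorant c e t.
Proof.
by move=> c0 e0 s0 st; rewrite !majorantE ler_wpM2l// ler_pM//; lra.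
Qed.

(** On [- e, 0] the majorant changes sign at [- e / 3], and its primitive
[H z = z * c * (z + e) ^+ 2] has the same value 0 at both ends.  An atom at 0 is
allowed, so the distribution function is only compared with its supporting line
up to [- t], and [t] tends to 0. *)
Lemma integral_majorant_neg (R : realType)
    (mu : probability R R) (c e : R) :
  convex_function (`]-oo, 0[%classic : set R^o)
    (fun z => fine (mu `]-oo, z]%classic)) ->
  0 < e -> 0 < c -> mu.-integrable setT (EFin \o majorant c e) ->
  0 <= \int[mu]_(z in `]-oo, 0]) majorant c e z.
Proof.
set F := fun z : R => fine (mu `]-oo, z]%classic).
move=> cvxF e0 c0 iQ.
have iQS A : measurable A -> mu.-integrable A (EFin \o majorant c e).
  by move=> mA; apply: integrableS iQ.
have muF s t : s <= t -> fine (mu `]s, t]%classic) = F t - F s.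
  exact: measure_itv_oc.
have c0' := ltW c0; have e0' := ltW e0.
have e3 : - (e / 3) < 0 by lra.
have [k [kL kR]] := supporting_slope_left cvxF e3.
rewrite -oppr_le0.
apply: (@le0_of_le_small _ _ (`|k| * c * e ^+ 2) (e / 3)); first lra.
move=> t t0 te.
pose H z := c * z ^+ 3 + 2 * c * e * z ^+ 2 + c * e ^+ 2 * z.
have He : H (- e) = 0 by rewrite /H; ring.
have Ht : - (k * H (- t)) <= `|k| * c * e ^+ 2 * t.
  have -> : - (k * H (- t)) = k * (c * t * (e - t) ^+ 2) by rewrite /H; ring.
  have ct : 0 <= c * t by rewrite mulr_ge0// ltW.
  apply: (@le_trans _ _ (`|k| * (c * t * (e - t) ^+ 2))).
    by rewrite ler_wpM2r ?ler_norm// mulr_ge0// sqr_ge0.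
  have -> : `|k| * c * e ^+ 2 * t = `|k| * (c * t * e ^+ 2) by ring.
  rewrite ler_wpM2l// ler_wpM2l// ler_sqr ?nnegrE; lra.
have J1 : k * (H (- (e / 3)) - H (- e)) <=
    \int[mu]_(z in `]- e, - (e / 3)]) majorant c e z.
  apply: integral_quadratic_ge_slope; [lra|exact: iQS|].
  move=> s r es sr re; rewrite -/(majorant c e s) muF//.
  by rewrite mulr_le0 ?subr_le0 ?kL// majorant_le0// (le_trans sr).
have J2 : k * (H (- t) - H (- (e / 3))) <=
    \int[mu]_(z in `]- (e / 3), - t]) majorant c e z.
  apply: integral_quadratic_ge_slope; [lra|exact: iQS|].
  move=> s r es sr re; rewrite -/(majorant c e s) muF//.
  rewrite mulr_ge0 ?subr_ge0 ?kR ?majorant_ge0_right//.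
  by rewrite (le_lt_trans re)// oppr_lt0.
have J3 : 0 <= \int[mu]_(z in `]-oo, - e]) majorant c e z.
  apply: Rintegral_ge0 => z; rewrite /= in_itv/= => ze.
  exact: majorant_ge0_left.
have J4 : 0 <= \int[mu]_(z in `]- t, 0]) majorant c e z.
  apply: Rintegral_ge0 => z; rewrite /= in_itv/= => /andP[tz _].
  by rewrite majorant_ge0_right//; lra.
have cat a b b' : (a <= b)%O -> (b <= b')%O ->
    \int[mu]_(z in [set` Interval a b']) majorant c e z =
    \int[mu]_(z in [set` Interval a b]) majorant c e z +
    \int[mu]_(z in [set` Interval b b']) majorant c e z.
  by move=> ab bb; apply: Rintegral_itv_cat => //; exact: iQS.
rewrite (@cat _ (BRight (- e)))//; last by rewrite bnd_simp; lra.
rewrite (@cat _ (BRight (- (e / 3))) (BRight 0))//; [|rewrite bnd_simp; lra..].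
rewrite (@cat _ (BRight (- t)) (BRight 0))//; [|rewrite bnd_simp; lra..].
move: J1 J2; rewrite He; clearbody H; clear -Ht J3 J4 => J1 J2; lra.
Qed.

(** On [0, y] the function [majorant c e - 1_(>= v)] changes sign at [v],
because the majorant increases up to its value 1 at [y]; the hypothesis
[c * y * (y + e) ^+ 2 = y - v] says that its primitive returns to 0 at [y].
Beyond [y] the majorant is at least 1. *)
Lemma integral_majorant_pos (R : realType)
    (mu : probability R R) (v y e c : R) :
  convex_function (`[0, +oo[%classic : set R^o)
    (fun z => - fine (mu `]-oo, z]%classic)) ->
  0 < v -> v < y -> 0 <= e -> 0 <= c ->
  c * y * (y + e) ^+ 2 = y - v -> majorant c e y = 1 ->
  mu.-integrable setT (EFin \o majorant c e) ->
  fine (mu `[v, +oo[%classic) <= \int[mu]_(z in `]0, +oo[) majorant c e z.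
Proof.
set F := fun z : R => fine (mu `]-oo, z]%classic).
move=> ccvF v0 vy e0 c0 touch Qy iQ.
have iQS A : measurable A -> mu.-integrable A (EFin \o majorant c e).
  by move=> mA; apply: integrableS iQ.
have muF s t : s <= t -> fine (mu `]s, t]%classic) = F t - F s.
  exact: measure_itv_oc.
have tailE : fine (mu `[v, +oo[%classic) =
    fine (mu `]v, y]%classic) + fine (mu `]y, +oo[%classic).
  have -> : `[v, +oo[%classic = [set v] `|` `]v, +oo[%classic :> set R.
    by rewrite setU1itv.
  rewrite measureU//= ?(concave_cdf_no_atom ccvF) ?add0e//; last first.
    by apply/seteqP; split => // z [] /= ->; rewrite in_itv/= ltxx.
  have -> : `]v, +oo[%classic = `]v, y]%classic `|` `]y, +oo[%classic :> set R.
    by rewrite -itv_bndbnd_setU// bnd_simp ltW.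
  rewrite measureU//= ?fineD ?fin_num_measure//.
  apply/seteqP; split => // z [] /=; rewrite !in_itv/= andbT.
  by move=> /andP[_ zy] /(le_lt_trans zy); rewrite ltxx.
have [k [kL kR]] := supporting_slope_right ccvF v0.
pose H z := c * z ^+ 3 + 2 * c * e * z ^+ 2 + c * e ^+ 2 * z.
have H0 : H 0 = 0 by rewrite /H; ring.
have Hy : H y - y = - v by move: touch; rewrite /H; lra.
have J3 : k * (H v - H 0) <= \int[mu]_(z in `]0, v]) majorant c e z.
  apply: integral_quadratic_ge_slope; [exact: ltW|exact: iQS|].
  move=> s r s0 sr rv; rewrite -/(majorant c e s) muF//.
  by rewrite mulr_ge0 ?subr_ge0 ?kL// majorant_ge0_right//; lra.
have J5 : \int[mu]_(z in `]v, y]) (majorant c e z - 1) =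
    \int[mu]_(z in `]v, y]) majorant c e z - fine (mu `]v, y]%classic).
  rewrite RintegralB//; [|exact: iQS|exact: finite_measure_integrable_cst].
  by rewrite Rintegral_cst// mul1r.
have J4 : k * ((H y - y) - (H v - v)) <=
    \int[mu]_(z in `]v, y]) (majorant c e z - 1).
  have -> : \int[mu]_(z in `]v, y]) (majorant c e z - 1) =
    \int[mu]_(z in `]v, y])
      (3 * c * z ^+ 2 + 2 * (2 * c * e) * z + (c * e ^+ 2 - 1)).
    by apply: eq_Rintegral => z _; rewrite /majorant addrA.
  have -> : (H y - y) - (H v - v) =
    (c * y ^+ 3 + 2 * c * e * y ^+ 2 + (c * e ^+ 2 - 1) * y) -
    (c * v ^+ 3 + 2 * c * e * v ^+ 2 + (c * e ^+ 2 - 1) * v) by rewrite /H; ring.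
  apply: integral_quadratic_ge_slope; [exact: ltW| |].
    rewrite [X in _.-integrable _ X](_ : _ =
        ((EFin \o majorant c e) \- (EFin \o cst 1%R))%E).
      apply: integrableB => //; first exact: iQS.
      exact: finite_measure_integrable_cst.
    by apply/funext => z /=; rewrite /majorant -EFinB addrA.
  move=> s r vs sr ry; rewrite addrA -/(majorant c e s) muF//.
  rewrite mulr_le0 ?subr_le0 ?kR// -Qy majorant_le//.
    by rewrite (le_trans (ltW v0)).
  by rewrite (le_trans sr).
have J6 : fine (mu `]y, +oo[%classic) <= \int[mu]_(z in `]y, +oo[) majorant c e z.
  rewrite -[leLHS]mul1r -Rintegral_cst// le_Rintegral//.
  - exact: finite_measure_integrable_cst.
  - exact: iQS.
  move=> z; rewrite /= in_itv/= andbT => yz.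
  by rewrite -[leLHS]Qy majorant_le// ltW// (lt_trans v0).
have cat a b b' : (a <= b)%O -> (b <= b')%O ->
    \int[mu]_(z in [set` Interval a b']) majorant c e z =
    \int[mu]_(z in [set` Interval a b]) majorant c e z +
    \int[mu]_(z in [set` Interval b b']) majorant c e z.
  by move=> ab bb; apply: Rintegral_itv_cat => //; exact: iQS.
rewrite tailE (@cat _ (BRight v))//; last by rewrite bnd_simp ltW.
rewrite (@cat _ (BRight y) +oo%O)//; last by rewrite bnd_simp ltW.
move: J3 J4; rewrite H0 Hy J5; clearbody H; clear -J6 => J3 J4; lra.
Qed.

Lemma unimodal_tail_le_integral (R : realType) (mu : probability R R)
    (F := fun z : R => fine (mu `]-oo, z]%classic)) (v y e c : R) :
  convex_function (`]-oo, 0[%classic : set R^o) F ->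
  convex_function (`[0, +oo[%classic : set R^o) (fun z => - F z) ->
  0 < v -> v < y -> 0 < e -> 0 < c ->
  c * y * (y + e) ^+ 2 = y - v -> majorant c e y = 1 ->
  mu.-integrable setT (EFin \o majorant c e) ->
  fine (mu `[v, +oo[%classic) <= \int[mu]_z majorant c e z.
Proof.
move=> cvxF ccvF v0 vy e0 c0 touch Qy iQ.
have -> : \int[mu]_z majorant c e z = \int[mu]_(z in `]-oo, +oo[) majorant c e z.
  by rewrite set_itvNyy.
rewrite (@Rintegral_itv_cat _ _ _ _ (BRight 0))//; last by rewrite set_itvNyy.
apply: ler_wpDl; first exact: integral_majorant_neg.
by apply: (integral_majorant_pos (y := y)) => //; exact: ltW.
Qed.

(** * The bound in terms of the first two moments *)

(** An integral of a function of which both the positive and the negative part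
have infinite integral is [-oo] by convention, so a finite value does imply
integrability. *)
Lemma integrable_of_fin_num d (T : measurableType d) (R : realType)
    (mu : {measure set T -> \bar R}) (f : T -> \bar R) :
  measurable_fun [set: T] f -> (\int[mu]_t f t)%E \is a fin_num ->
  mu.-integrable [set: T] f.
Proof.
move=> mf; rewrite integralE fin_numB => /andP[fp fn].
have mfp := measurable_funepos mf; have mfn := measurable_funeneg mf.
apply/integrableP; split => //.
have -> : (\int[mu]_t `|f t| = \int[mu]_t (f^\+ t + f^\- t))%E.
  by apply: eq_integral => t _; rewrite -[RHS](congr1 (@^~ t) (fune_abse f)).
by rewrite ge0_integralD// ltey_eq fin_numD fp fn.
Qed.

Lemma variance_mean0 d (T : measurableType d) (R : realType)
    (P : probability T R) (Z : {RV P >-> R}) :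
  ('E_P[Z] = 0 -> 'V_P[Z] = \int[P]_t ((Z t ^+ 2)%R)%:E)%E.
Proof.
move=> EZ; rewrite /variance unlock EZ /= unlock.
by apply: eq_integral => t _; congr EFin; rewrite expr2 -[in RHS](subr0 (Z t)).
Qed.

Lemma measurable_quadratic (R : realType) (a b c : R) :
  measurable_fun [set: R] (fun z : R => a * z ^+ 2 + b * z + c).
Proof.
apply: measurable_funD; last exact: measurable_cst.
apply: measurable_funD; apply: measurable_funM; try exact: measurable_cst.
  by apply: measurable_funX; exact: measurable_id.
exact: measurable_id.
Qed.

Lemma unimodal_tail_le_moments d (T : measurableType d) (R : realType)
  (P : probability T R) (Z : {RV P >-> R}) (v y e c : R) :
  ('E_P[Z] = 0)%E -> ('V_P[Z] = 1)%E -> unimodal Z 0 ->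
  0 < v -> v < y -> 0 < e -> 0 < c ->
  c * y * (y + e) ^+ 2 = y - v -> majorant c e y = 1 ->
  (P [set t | (v <= Z t)%R] <= (c * (3 + e ^+ 2))%:E)%E.
Proof.
move=> EZ VZ [cvxF ccvF] v0 vy e0 c0 touch Qy.
have mZ : measurable_fun [set: T] (Z : T -> R) by [].
have IZ : (\int[P]_t (Z t)%:E)%E = 0%E by rewrite -expectation_def.
have IZ2 : (\int[P]_t (Z t ^+ 2)%:E)%E = 1%E.
  by rewrite -variance_mean0.
have iZ : P.-integrable [set: T] (EFin \o Z).
  by apply: integrable_of_fin_num; rewrite ?IZ//; exact/measurable_EFinP.
have iZ2 : P.-integrable [set: T] (EFin \o (fun t => Z t ^+ 2)).
  apply: integrable_of_fin_num; rewrite /= ?IZ2//.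
  by apply/measurable_EFinP; exact: measurable_funX.
have i1 : P.-integrable [set: T] (EFin \o cst (c * e ^+ 2)).
  exact: finite_measure_integrable_cst.
have iaZ2 : P.-integrable [set: T] (EFin \o (fun t => 3 * c * Z t ^+ 2)).
  by apply: integrableZl iZ2.
have iaZ : P.-integrable [set: T] (EFin \o (fun t => 2 * (2 * c * e) * Z t)).
  by apply: integrableZl iZ.
have iaZ12 : P.-integrable [set: T]
   (EFin \o (fun t => 3 * c * Z t ^+ 2 + 2 * (2 * c * e) * Z t)).
  by apply: integrableD iaZ2 iaZ.
have iQZ : P.-integrable [set: T] (EFin \o (fun t => majorant c e (Z t))).
  by apply: integrableD iaZ12 i1.
have IQ : \int[P]_t majorant c e (Z t) = c * (3 + e ^+ 2).
  rewrite /majorant RintegralD// RintegralD// RintegralZl// RintegralZl//.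
  have -> : \int[P]__ (c * e ^+ 2) = c * e ^+ 2.
    rewrite Rintegral_cst// [X in fine X](_ : _ = 1%E) ?mulr1//.
    exact: probability_setT.
  by rewrite /Rintegral IZ IZ2 /=; ring.
pose mu : probability R R := distribution P Z.
have mQ : measurable_fun [set: R] (EFin \o majorant c e).
  by apply/measurable_EFinP; exact: measurable_quadratic.
have iQ : mu.-integrable setT (EFin \o majorant c e).
  by apply: integrable_pushforward; rewrite ?preimage_setT.
have Imu : \int[mu]_z majorant c e z = c * (3 + e ^+ 2).
  rewrite -IQ /Rintegral; congr fine.
  by rewrite (integral_distribution (X := Z)).
have -> : [set t | (v <= Z t)%R] = Z @^-1` `[v, +oo[%classic.
  by apply/seteqP; split => t /=; rewrite in_itv/= andbT.
rewrite -[leLHS]fineK; last first.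
  by rewrite fin_num_measure//; exact: measurable_funPTI.
rewrite lee_fin -Imu.
exact: (@unimodal_tail_le_integral _ mu v y e c).
Qed.

(** * Products of a uniform and a two-valued random variable *)

Lemma integrable_null_complement d (T : measurableType d) (R : realType)
    (mu : {measure set T -> \bar R}) (D : set T) (f : T -> \bar R) :
  measurable D -> measurable_fun [set: T] f -> mu (~` D) = 0%E ->
  mu.-integrable D f -> mu.-integrable [set: T] f.
Proof.
move=> mD mf D0 /integrableP[_ iD]; apply/integrableP; split => //.
rewrite -(setUv D) ge0_integral_setU//=; last 3 first.
- exact: measurableC.
- by rewrite setUv; exact: measurableT_comp.
- exact/disj_set2P/setICr.
rewrite [X in (_ + X)%E]null_set_integral ?adde0//; first exact: measurableC.
by apply: measurable_funTS; exact: measurableT_comp.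
Qed.

Lemma probability_two_cases d (T : measurableType d) (R : realType)
    (P : probability T R) (A1 A2 S : set T) :
  measurable A1 -> measurable A2 -> measurable S -> A1 `&` A2 = set0 ->
  (P A1 + P A2 = 1)%E -> P S = (P (S `&` A1) + P (S `&` A2))%E.
Proof.
move=> mA1 mA2 mS A12 PA.
have mA : measurable (A1 `|` A2) by exact: measurableU.
have PC : P (~` (A1 `|` A2)) = 0%E.
  by rewrite probability_setC// measureU// PA subee.
rewrite (measureDI P mS mA) setDE.
rewrite [X in (X + _)%E](_ : _ = 0%E) ?add0e; last first.
  apply: subset_measure0 PC; [|exact: measurableC|exact: subIsetr].
  by apply: measurableI => //; exact: measurableC.
rewrite setIUr measureU//; [exact: measurableI|exact: measurableI|].
by rewrite setIACA setIid A12 setI0.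
Qed.

Lemma uniform_probE (R : realType) (A : set R) :
  measurable A ->
  uniform_prob (@ltr01 R) A = lebesgue_measure (A `&` `[0, 1]%classic).
Proof.
move=> mA; rewrite /uniform_prob integral_uniform_pdf.
transitivity (\int[lebesgue_measure]_(z in A `&` `[0%R, 1%R]) 1)%E.
  apply: eq_integral => z; rewrite inE/= in_itv/= => -[_ z01].
  by rewrite /uniform_pdf z01 subr0 invr1.
rewrite integral_cst ?mul1e//; apply: measurableI => //.
Qed.

(** The distribution function of the uniform law on the unit interval. *)
Definition clip (R : realType) (u : R) : R := Num.max 0 (Num.min 1 u).

Lemma clip_le0 (R : realType) (u : R) : u <= 0 -> clip u = 0.
Proof. by move=> u0; rewrite /clip max_l// ge_min u0 orbT. Qed.

Lemma clip_ge1 (R : realType) (u : R) : 1 <= u -> clip u = 1.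
Proof. by move=> u1; rewrite /clip (min_l u1) (max_r ler01). Qed.

Lemma clip_id (R : realType) (u : R) : 0 <= u -> u <= 1 -> clip u = u.
Proof. by move=> u0 u1; rewrite /clip (min_r u1) (max_r u0). Qed.

Lemma clip_concave (R : realType) (t a b : R) : 0 <= t -> t <= 1 ->
  0 <= a -> 0 <= b ->
  t * clip a + (1 - t) * clip b <= clip (t * a + (1 - t) * b).
Proof.
move=> t0 t1 a0 b0.
have s0 : 0 <= 1 - t by lra.
have clip0 u : 0 <= u -> clip u = Num.min 1 u.
  by move=> u0; rewrite /clip max_r// le_min ler01.
have ab0 : 0 <= t * a + (1 - t) * b by rewrite addr_ge0// mulr_ge0.
rewrite !clip0// le_min; apply/andP; split.
  have ma : Num.min 1 a <= 1 by rewrite ge_min lexx.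
  have mb : Num.min 1 b <= 1 by rewrite ge_min lexx.
  have := ler_wpM2l t0 ma; have := ler_wpM2l s0 mb; lra.
by rewrite lerD// ler_wpM2l// ge_min lexx orbT.
Qed.

Lemma uniform_prob_le (R : realType) (u : R) :
  uniform_prob (@ltr01 R) `]-oo, u]%classic = (clip u)%:E.
Proof.
rewrite uniform_probE//.
have -> : `]-oo, u] `&` `[0, 1] = `[0, Num.min 1 u]%classic :> set R.
  apply/seteqP; split => z /=; rewrite !in_itv/= le_min.
    by move=> [-> /andP[-> ->]].
  by move=> /andP[-> /andP[-> ->]].
rewrite lebesgue_measure_itv/= lte_fin /clip.
by have [m0|m0] := ltP 0 (Num.min 1 u); rewrite ?sube0.
Qed.

Lemma uniform_prob_ge (R : realType) (u : R) :
  uniform_prob (@ltr01 R) `[u, +oo[%classic = (1 - clip u)%:E.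
Proof.
rewrite uniform_probE//.
have -> : `[u, +oo[ `&` `[0, 1] = `[Num.max 0 u, 1]%classic :> set R.
  apply/seteqP; split => z /=; rewrite !in_itv/= andbT ge_max.
    by move=> [-> /andP[-> ->]].
  by move=> /andP[/andP[-> ->] ->].
rewrite lebesgue_measure_itv/= lte_fin /clip.
have [u0|u0] := orP (le_total u 0).
  rewrite (max_l u0) (min_r (le_trans u0 ler01)) (max_l u0) ltr01.
  by rewrite sube0 subr0.
rewrite (max_r u0); have [u1|u1] := ltP u 1.
  by rewrite (max_r u0) -EFinB.
by rewrite (max_r ler01) subrr.
Qed.

(** Conditionally on [Y = c] the product is [c * U], and the two values of [Y]
exhaust the whole mass. *)
Lemma two_point_product_law d (T : measurableType d) (R : realType)
    (P : probability T R) (U Y Z : {RV P >-> R}) (c1 c2 p1 p2 : R) (B : set R) :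
  independent_RVs U Y -> uniform_RV U (@ltr01 R) -> c1 != c2 ->
  P [set t | Y t = c1] = p1%:E -> P [set t | Y t = c2] = p2%:E ->
  p1 + p2 = 1 -> (forall t, Z t = U t * Y t) -> measurable B ->
  distribution P Z B =
    (p1%:E * uniform_prob (@ltr01 R) ((fun u : R => (u * c1)%R) @^-1` B)
     + p2%:E * uniform_prob (@ltr01 R) ((fun u : R => (u * c2)%R) @^-1` B))%E.
Proof.
move=> indep unif c12 P1 P2 p12 ZE mB.
have mY c : measurable (Y @^-1` [set c]) by exact: measurable_funPTI.
have mM c : measurable ((fun u : R => u * c) @^-1` B).
  rewrite -[X in measurable X]setTI.
  have mf : measurable_fun [set: R] (fun u : R => u * c).
    by apply: measurable_funM; [exact: measurable_id|exact: measurable_cst].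
  exact: mf.
have disjY : Y @^-1` [set c1] `&` Y @^-1` [set c2] = set0.
  apply/seteqP; split => // t [] /= -> c1c2.
  by move: c12; rewrite c1c2 eqxx.
have PY : (P (Y @^-1` [set c1]) + P (Y @^-1` [set c2]) = 1)%E.
  by rewrite [P _]P1 [X in (_ + X)%E]P2 -EFinD p12.
rewrite /distribution /pushforward.
rewrite (probability_two_cases (mY c1) (mY c2) _ disjY PY)//; last first.
  exact: measurable_funPTI.
have E c : Z @^-1` B `&` Y @^-1` [set c] =
    U @^-1` ((fun u : R => u * c) @^-1` B) `&` Y @^-1` [set c].
  by apply/seteqP; split => t [] /=; rewrite ZE => + Yt; rewrite Yt.
rewrite !E !indep//; try exact: mM; try exact: measurable_set1.
rewrite -!(unif _ (mM _)).
by congr (_ + _)%E; rewrite muleC; congr (_ * _)%E.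
Qed.

Lemma two_point_product_cdf d (T : measurableType d) (R : realType)
    (P : probability T R) (U Y Z : {RV P >-> R}) (e y p q r : R) :
  independent_RVs U Y -> uniform_RV U (@ltr01 R) -> 0 < e -> 0 < y ->
  P [set t | Y t = - e] = p%:E -> P [set t | Y t = y] = q%:E ->
  p + q = 1 -> (forall t, Z t = U t * Y t) ->
  distribution P Z `]-oo, r]%classic =
    (p * (1 - clip (- r / e)) + q * clip (r / y))%:E.
Proof.
move=> indep unif e0 y0 P1 P2 pq ZE.
have ey : - e != y by rewrite lt_eqF//; lra.
rewrite (two_point_product_law indep unif ey P1 P2 pq ZE)//.
have -> : (fun u : R => u * - e) @^-1` `]-oo, r] = `[- r / e, +oo[%classic :> set R.
  apply/seteqP; split => u /=; rewrite !in_itv/= andbT.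
    by rewrite mulrN lerNl ler_pdivrMr.
  by rewrite mulrN lerNl ler_pdivrMr.
have -> : (fun u : R => u * y) @^-1` `]-oo, r] = `]-oo, r / y]%classic :> set R.
  by apply/seteqP; split => u /=; rewrite !in_itv/= ler_pdivlMr.
by rewrite uniform_prob_le uniform_prob_ge -!EFinM -EFinD.
Qed.

(** The formula for the distribution function shows that the law is carried by
[`]- e, y]] and has density [p / e] on [- e, 0] and [q / y] on [0, y]. *)
Lemma two_point_product_moment d (T : measurableType d) (R : realType)
    (P : probability T R) (Z : {RV P >-> R}) (e y p q a b c : R)
    (g := fun z => 3 * a * z ^+ 2 + 2 * b * z + c)
    (H := fun z => a * z ^+ 3 + b * z ^+ 2 + c * z) :
  0 < e -> 0 < y -> p + q = 1 ->
  (forall r, distribution P Z `]-oo, r]%classic =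
    (p * (1 - clip (- r / e)) + q * clip (r / y))%:E) ->
  (\int[P]_t (g (Z t))%:E =
    (p / e * (H 0 - H (- e)) + q / y * (H y - H 0))%:E)%E.
Proof.
move=> e0 y0 pq cdfZ.
pose mu : probability R R := distribution P Z.
have cdfmu r : mu `]-oo, r]%classic =
    (p * (1 - clip (- r / e)) + q * clip (r / y))%:E by exact: cdfZ.
have muoc s t : s <= t -> fine (mu `]s, t]%classic) =
    p * (1 - clip (- t / e)) + q * clip (t / y)
    - (p * (1 - clip (- s / e)) + q * clip (s / y)).
  by move=> st; rewrite measure_itv_oc// !cdfmu.
pose D : set R := `]- e, y]%classic.
have mD : measurable D by exact: measurable_itv.
have muD : mu D = 1%E.
  rewrite -[mu D]fineK ?fin_num_measure// muoc; last lra.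
  rewrite opprK !divff ?gt_eqF// (clip_ge1 (lexx 1)).
  rewrite !clip_le0 ?mulr_le0_ge0 ?invr_ge0 ?oppr_le0 ?(ltW e0) ?(ltW y0)//.
  congr EFin; lra.
have muDC : mu (~` D) = 0%E by rewrite probability_setC// muD subee.
have mg : measurable_fun [set: R] (EFin \o g).
  by apply/measurable_EFinP; exact: measurable_quadratic.
have igD : mu.-integrable D (EFin \o g).
  apply: measurable_bounded_integrable => //.
  - by rewrite -ge0_fin_numE// fin_num_measure.
  - exact/measurable_funTS/measurable_EFinP.
  pose m := e + y.
  exists (3 * `|a| * m ^+ 2 + 2 * `|b| * m + `|c|); split; first exact: num_real.
  move=> M /ltW gM z; rewrite /D /= in_itv/= => /andP[ez zy].
  apply: (le_trans _ gM).
  have zm : `|z| <= m by rewrite ler_norml /m; apply/andP; split; lra.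
  rewrite /g (le_trans (ler_normD _ _))// lerD2r (le_trans (ler_normD _ _))//.
  have -> : `|3 * a * z ^+ 2| = 3 * `|a| * `|z| ^+ 2.
    by rewrite normrM normrX normrM (ger0_norm (_ : 0 <= 3)).
  have -> : `|2 * b * z| = 2 * `|b| * `|z|.
    by rewrite normrM normrM (ger0_norm (_ : 0 <= 2)).
  rewrite lerD// ler_wpM2l ?mulr_ge0// ler_sqr ?nnegrE//.
  by rewrite addr_ge0// ltW.
have ig : mu.-integrable [set: R] (EFin \o g).
  exact: integrable_null_complement muDC igD.
have igZ : P.-integrable [set: T] (EFin \o g \o Z).
  apply/integrableP; split; first exact: measurableT_comp.
  move/integrableP : (ig) => [_]; apply: le_lt_trans.
  rewrite ge0_integral_distribution//; exact: measurableT_comp.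
rewrite -[LHS](integral_distribution mg igZ).
rewrite -[LHS]fineK; last exact: integrable_fin_num.
congr EFin.
rewrite (negligible_integral (N := ~` D))//; last exact: measurableC.
rewrite setTD setCK.
rewrite -/(Rintegral mu D g) /D (@Rintegral_itv_cat _ _ _ _ (BRight 0))//; last 2 first.
- by rewrite bnd_simp; lra.
- by rewrite bnd_simp ltW.
have iS A : measurable A -> mu.-integrable A (EFin \o g).
  by move=> mA; apply: integrableS ig.
have clipL s : - e <= s -> s <= 0 -> clip (- s / e) = - s / e /\ clip (s / y) = 0.
  move=> es s0; split; last by rewrite clip_le0// pmulr_lle0// invr_gt0.
  by rewrite clip_id ?ler_pdivrMr ?divr_ge0//; lra.
have clipR s : 0 <= s -> s <= y -> clip (- s / e) = 0 /\ clip (s / y) = s / y.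
  move=> s0 sy; split; first by rewrite clip_le0// pmulr_lle0 ?invr_gt0//; lra.
  by rewrite clip_id ?ler_pdivrMr ?divr_ge0//; lra.
congr (_ + _); apply: integral_quadratic_uniform; try exact: iS; try lra.
- move=> s t es st t0; rewrite muoc//.
  have [-> ->] := clipL s es (le_trans st t0).
  have [-> ->] := clipL t (le_trans es st) t0.
  by field; rewrite gt_eqF.
- move=> s t s0 st ty; rewrite muoc//.
  have [-> ->] := clipR s s0 (le_trans st ty).
  have [-> ->] := clipR t (le_trans s0 st) ty.
  by field; rewrite gt_eqF.
Qed.

Lemma two_point_product_unimodal d (T : measurableType d) (R : realType)
    (P : probability T R) (Z : {RV P >-> R}) (e y p q : R) :
  0 < e -> 0 < y -> 0 <= p -> 0 <= q ->
  (forall r, distribution P Z `]-oo, r]%classic =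
    (p * (1 - clip (- r / e)) + q * clip (r / y))%:E) ->
  unimodal Z 0.
Proof.
move=> e0 y0 p0 q0 cdfZ.
have eV : 0 <= e^-1 by rewrite invr_ge0 ltW.
have yV : 0 <= y^-1 by rewrite invr_ge0 ltW.
have cdfE r : fine (cdf Z r) = p * (1 - clip (- r / e)) + q * clip (r / y).
  by rewrite /cdf cdfZ.
split; apply/convex_functionP => t a b t0 t1; rewrite /= !in_itv/= ?andbT => a0 b0;
  have s0 : 0 <= 1 - t by lra.
- have ab : t * a + (1 - t) * b <= 0.
    by rewrite -oppr_ge0 opprD addr_ge0// -mulrN mulr_ge0// oppr_ge0 ltW.
  have cy z : z <= 0 -> clip (z / y) = 0.
    by move=> z0; rewrite clip_le0// mulr_le0_ge0.
  rewrite !cdfE (cy _ ab) (cy _ (ltW a0)) (cy _ (ltW b0)).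
  have aN : 0 <= - a / e by rewrite mulr_ge0// oppr_ge0 ltW.
  have bN : 0 <= - b / e by rewrite mulr_ge0// oppr_ge0 ltW.
  have := clip_concave t0 t1 aN bN.
  have -> : t * (- a / e) + (1 - t) * (- b / e) = - (t * a + (1 - t) * b) / e.
    by ring.
  move=> /(ler_wpM2l p0); lra.
- have ab : 0 <= t * a + (1 - t) * b by rewrite addr_ge0// mulr_ge0.
  rewrite !cdfE !(@clip_le0 _ (- _ / e)) ?mulr_le0_ge0 ?oppr_le0//.
  have := clip_concave t0 t1 (mulr_ge0 a0 yV) (mulr_ge0 b0 yV).
  have -> : t * (a / y) + (1 - t) * (b / y) = (t * a + (1 - t) * b) / y.
    by ring.
  move=> /(ler_wpM2l q0); lra.
Qed.

Lemma two_point_product_tail d (T : measurableType d) (R : realType)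
    (P : probability T R) (Z : {RV P >-> R}) (e y p q v : R) :
  0 < e -> 0 < v -> v <= y -> p + q = 1 -> unimodal Z 0 ->
  (forall r, distribution P Z `]-oo, r]%classic =
    (p * (1 - clip (- r / e)) + q * clip (r / y))%:E) ->
  P [set t | v <= Z t] = (q * (1 - v / y))%:E.
Proof.
move=> e0 v0 vy pq [_ ccvF] cdfZ.
have y0 : 0 < y by exact: lt_le_trans vy.
pose mu : probability R R := distribution P Z.
have cdfmu r : mu `]-oo, r]%classic =
    (p * (1 - clip (- r / e)) + q * clip (r / y))%:E by exact: cdfZ.
transitivity (mu `[v, +oo[%classic).
  by congr (P _); apply/seteqP; split => t /=; rewrite in_itv/= andbT.
have -> : `[v, +oo[%classic = [set v] `|` ~` `]-oo, v]%classic :> set R.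
  by rewrite setCitvl setU1itv.
rewrite measureU//=; last first.
- by apply/seteqP; split => // z [] /= ->; rewrite in_itv/= lexx.
- exact: measurableC.
rewrite (@concave_cdf_no_atom _ mu)// add0e probability_setC// cdfmu.
rewrite clip_le0 ?clip_id.
- by congr EFin; lra.
- by rewrite divr_ge0// ltW.
- by rewrite ler_pdivrMr// mul1r.
- by rewrite pmulr_lle0 ?invr_gt0// oppr_le0 ltW.
Qed.

(** * The extremal parameters *)

(** With [a] and [b] the sum and the difference of the two square roots,
[a * b = v ^+ 2], so [w ^+ 3 = a ^+ 2 / v ^+ 2] and its inverse is
[b ^+ 2 / v ^+ 2]; these add up to [2 + 12 / v ^+ 2].  In terms of
[w + 1 / w = 2 * x - 1] this is the cubic. *)
Lemma parameter_cubic (R : realType) (v : R) (v_gt0 : 0 < v)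
  (w := (Num.sqrt (3 + v ^+ 2) + Num.sqrt 3) `^ (2 / 3) * v `^ (- (2 / 3)))
  (x := 1 / 2 * (w + 1 + 1 / w)) :
  3 / 2 <= x /\ 2 * v ^+ 2 * x ^+ 3 = 3 * v ^+ 2 * x ^+ 2 + 3.
Proof.
pose a := Num.sqrt (3 + v ^+ 2) + Num.sqrt 3.
pose b := Num.sqrt (3 + v ^+ 2) - Num.sqrt 3.
have sv : Num.sqrt (3 + v ^+ 2) ^+ 2 = 3 + v ^+ 2.
  by rewrite sqr_sqrtr// addr_ge0// sqr_ge0.
have s3 : Num.sqrt 3 ^+ 2 = 3 :> R by rewrite sqr_sqrtr.
have a0 : 0 < a by rewrite ltr_wpDl ?sqrtr_ge0// sqrtr_gt0.
have ab : a * b = v ^+ 2 by rewrite /a /b mulrC -subr_sqr sv s3; ring.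
have a2b2 : a ^+ 2 + b ^+ 2 = 2 * (6 + v ^+ 2).
  have -> : a ^+ 2 + b ^+ 2 =
    2 * (Num.sqrt (3 + v ^+ 2) ^+ 2 + Num.sqrt 3 ^+ 2) by rewrite /a /b; ring.
  by rewrite sv s3; ring.
have a' : a != 0 by rewrite gt_eqF.
have w0 : 0 < w by rewrite mulr_gt0// powR_gt0.
have v20 : v ^+ 2 != 0 by rewrite expf_neq0// gt_eqF.
have w3 : w ^+ 3 = a ^+ 2 / v ^+ 2.
  have pow3 (u s : R) : (u `^ s) ^+ 3 = u `^ (s * 3%:R).
    by rewrite powRrM powR_mulrn// powR_ge0.
  rewrite /w exprMn -/a !pow3.
  have -> : 2 / 3 * 3%:R = 2%:R :> R by field.
  have -> : - (2 / 3) * 3%:R = - 2%:R :> R by field.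
  by rewrite powRN !powR_mulrn// ltW.
have w3V : (w ^+ 3)^-1 = b ^+ 2 / v ^+ 2.
  rewrite w3 invf_div; apply/eqP; rewrite eqr_div ?v20 ?expf_neq0//.
  by rewrite -ab; apply/eqP; ring.
have sum : w ^+ 3 + (w ^+ 3)^-1 = 2 + 12 / v ^+ 2.
  by rewrite w3V w3 -mulrDl a2b2; field; rewrite gt_eqF.
have w' : w != 0 by rewrite gt_eqF.
have xE : x = 1 / 2 * (w + 1 + 1 / w) by [].
clearbody x w; clear -w' v20 w0 sum xE v_gt0; split.
  have -> : x = (w - 1) ^+ 2 / (2 * w) + 3 / 2 by rewrite xE; field.
  by rewrite lerDr divr_ge0 ?sqr_ge0// mulr_ge0// ltW.
apply/eqP; rewrite -subr_eq0; apply/eqP.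
have -> : 2 * v ^+ 2 * x ^+ 3 - (3 * v ^+ 2 * x ^+ 2 + 3) =
   v ^+ 2 / 4 * (w ^+ 3 + (w ^+ 3)^-1 - 2) - 3 by rewrite xE; field.
by rewrite sum; field; rewrite gt_eqF.
Qed.

(** The cubic expresses [x], hence [v] and all the other parameters, as rational
functions of [y], which reduces the claims to identities in [y]. *)
Lemma extremal_parameters (R : realType) (v x : R)
    (y := v * x) (e := 3 / y) (c := 1 / (2 * x * (v ^+ 2 * x ^+ 2 + 3)))
    (q := 3 / (3 + v ^+ 2 * x ^+ 2))
    (bound := 2 * (x - 1) / (v ^+ 2 * x ^+ 2 + 2 * x + 1)) :
  0 < v -> 0 < x -> 2 * v ^+ 2 * x ^+ 3 = 3 * v ^+ 2 * x ^+ 2 + 3 ->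
  [/\ c * y * (y + e) ^+ 2 = y - v, majorant c e y = 1,
      c * (3 + e ^+ 2) = bound & q * (1 - v / y) = bound].
Proof.
move=> v0 x0 cubic.
have y0 : 0 < y by rewrite mulr_gt0.
have xE : x = (3 * y ^+ 2 + 3) / (2 * y ^+ 2).
  have y2 : 2 * y ^+ 2 != 0 by rewrite mulf_neq0// expf_neq0// gt_eqF.
  apply: (canRL (mulfK y2)).
  have -> : x * (2 * y ^+ 2) = 2 * v ^+ 2 * x ^+ 3 by rewrite /y; ring.
  by rewrite cubic /y; ring.
have vE : v = y / x by rewrite /y mulfK// gt_eqF.
have y2 : 0 < y ^+ 2 by rewrite exprn_gt0.
have n0 : y != 0 by rewrite gt_eqF.
have n1 : 3 * y ^+ 2 + 3 != 0 by rewrite gt_eqF//; lra.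
have n2 : 3 + y ^+ 2 != 0 by rewrite gt_eqF//; lra.
have n3 : y ^+ 2 + 3 != 0 by rewrite gt_eqF//; lra.
have n5 : (y * y) ^+ 2 + (3 * y ^+ 2 + 3) + y ^+ 2 != 0.
  by rewrite gt_eqF//; have := sqr_ge0 (y * y); lra.
have vx : v ^+ 2 * x ^+ 2 = y ^+ 2 by rewrite /y exprMn.
rewrite /c /q /bound vx /e majorantE.
move: vE; rewrite xE; clearbody y => ->.
clear -n0 n1 n2 n3 n5.
by split; field; rewrite ?n0 ?n1 ?n2 ?n3 ?n5.
Qed.

Theorem theorem6p1 (R : realType) (v : R) (v_gt0 : 0 < v)
    (d : measure_display) (T : measurableType d) (P : probability T R) :
  let w := (Num.sqrt (3 + v ^+ 2) + Num.sqrt 3) `^ (2 / 3)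
           * v `^ (- (2 / 3)) in
  let x := 1 / 2 * (w + 1 + 1 / w) in
  let bound := 2 * (x - 1) / (v ^+ 2 * x ^+ 2 + 2 * x + 1) in
  (forall Z : {RV P >-> R},
     ('E_P[Z] = 0)%E -> ('V_P[Z] = 1)%E -> unimodal Z 0 ->
     (P [set t | (v <= Z t)%R] <= bound%:E)%E) /\
  (forall U Y Z : {RV P >-> R},
     independent_RVs U Y ->
     uniform_RV U (@ltr01 R) ->
     P [set t | Y t = - (3 / (v * x))]
       = (v ^+ 2 * x ^+ 2 / (3 + v ^+ 2 * x ^+ 2))%:E ->
     P [set t | Y t = v * x] = (3 / (3 + v ^+ 2 * x ^+ 2))%:E ->
     (forall t, Z t = U t * Y t) ->
     [/\ ('E_P[Z] = 0)%E, ('V_P[Z] = 1)%E, unimodal Z 0 &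
         P [set t | v <= Z t] = bound%:E]).
Proof.
move=> w x bound.
have [x32 cubic] : 3 / 2 <= x /\ 2 * v ^+ 2 * x ^+ 3 = 3 * v ^+ 2 * x ^+ 2 + 3.
  exact: parameter_cubic.
clearbody x; clear w.
have x0 : 0 < x by lra.
have y0 : 0 < v * x by rewrite mulr_gt0.
have vy : v < v * x by rewrite ltr_pMr//; lra.
have e0 : 0 < 3 / (v * x) by rewrite divr_gt0.
have s0 : 0 < 3 + v ^+ 2 * x ^+ 2 by rewrite ltr_pwDl// mulr_ge0// sqr_ge0.
have c0 : 0 < 1 / (2 * x * (v ^+ 2 * x ^+ 2 + 3)).
  by rewrite divr_gt0// mulr_gt0 ?mulr_gt0//; lra.
have [touch tangent cE tailE] := extremal_parameters v_gt0 x0 cubic.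
split=> [Z EZ VZ uZ|U Y Z indep unif PY1 PY2 ZE].
  by rewrite /bound -cE; apply: (unimodal_tail_le_moments (y := v * x)).
have pq : v ^+ 2 * x ^+ 2 / (3 + v ^+ 2 * x ^+ 2) + 3 / (3 + v ^+ 2 * x ^+ 2) = 1.
  by rewrite -mulrDl addrC divff// gt_eqF.
have cdfZ r := two_point_product_cdf r indep unif e0 y0 PY1 PY2 pq ZE.
have moment a b c := two_point_product_moment a b c e0 y0 pq cdfZ.
have uZ : unimodal Z 0.
  apply: two_point_product_unimodal cdfZ => //; rewrite divr_ge0 ?ltW//.
  by rewrite mulr_gt0 ?exprn_gt0.
have side : [&& x != 0, v != 0 & 3 + (v * x) ^+ 2 != 0].
  by rewrite exprMn !gt_eqF.
have EZ : ('E_P[Z] = 0)%E.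
  rewrite expectation_def.
  transitivity (\int[P]_t (3 * 0 * Z t ^+ 2 + 2 * (1 / 2) * Z t + 0)%:E)%E.
    by apply: eq_integral => t _; congr EFin; field.
  by rewrite moment; congr EFin; field.
split => //.
  rewrite variance_mean0//.
  transitivity (\int[P]_t (3 * (1 / 3) * Z t ^+ 2 + 2 * 0 * Z t + 0)%:E)%E.
    by apply: eq_integral => t _; congr EFin; field.
  by rewrite moment; congr EFin; field.
rewrite (two_point_product_tail e0 v_gt0 (ltW vy) pq uZ cdfZ).
by rewrite /bound -tailE.
Qed.
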